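(* Let $\ell$ be a prime number and $q$ a prime power with $\ell\mid q-1$. For every integer $k\geqslant 1$, $$\left|\sum_{A,B\in\mathbb{F}_q^\times}a_{q,\ell}(A,B)^k\right|\leqslant q^{k/2}(q-1)^2(\ell-1)(\ell-2)^{k-1}\left(\frac{(\ell-1)^{k-1}-(-1)^{k-1}}{\ell}\right).$$
   Context: $\mathbb{F}_q$ is the finite field with $q$ elements. For $A,B\in\mathbb{F}_q^\times$, let $N_{q,\ell}(A,B)$ be the number of $\mathbb{F}_q$-rational points on the projective plane curve $Ax^\ell+By^\ell=z^\ell$ in $\mathbb{P}^2_{\mathbb{F}_q}$, i.e. the number of points $[x:y:z]\in\mathbb{P}^2(\mathbb{F}_q)$ satisfying this equation, and put $$a_{q,\ell}(A,B):=N_{q,\ell}(A,B)-(q+1).$$ The sum is over all pairs $(A,B)\in\mathbb{F}_q^\times\times\mathbb{F}_q^\times$. The convention $t^0=1$ is used for every real number $t$, including $t=0$. *)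

(* Defs.v *)
From mathcomp Require Import all_boot all_algebra.

Set Implicit Arguments.
Unset Strict Implicit.
Unset Printing Implicit Defensive.

Import GRing.Theory.
Local Open Scope ring_scope.

(* The point [x : y : z] of P^2(F), as the set of all homogeneous coordinate
   vectors representing it; only meaningful for v != 0. *)
Definition proj_point (F : finFieldType) (v : 'rV[F]_3) : {set 'rV[F]_3} :=
  [set c *: v | c : F & c != 0].

Definition on_curve (F : finFieldType) (l : nat) (A B : F) (v : 'rV[F]_3) : bool :=
  A * v 0 0 ^+ l + B * v 0 1 ^+ l == v 0 2 ^+ l.

Definition curve_points (F : finFieldType) (l : nat) (A B : F) :
    {set {set 'rV[F]_3}} :=
  [set proj_point v | v : 'rV[F]_3 & (v != 0) && on_curve l A B v].

Definition a_coef (F : finFieldType) (l : nat) (A B : F) : int :=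
  #|curve_points l A B|%:Z - (#|F| + 1)%:Z.

(* Main.v *)
Require Import Defs.
From mathcomp Require Import all_boot all_order all_algebra all_solvable all_field.
From mathcomp Require Import reals exp.
From mathcomp Require Import ring.

Import Order.TTheory GRing.Theory Num.Theory.
Local Open Scope ring_scope.

(** The character method. Fix a surjective logarithm dl : F^* -> Z/l and a
    primitive l-th root of unity; they give the characters chi i, i in Z/l,
    of F^* of order dividing l. The number of l-th roots of u is the sum of
    the chi i u, so counting the points of A x^l + B y^l = z^l, affine points
    first and the line at infinity separately, turns a(A, B) into
      a(A, B) = sum of J(i, j) chi(-i)(A) chi(-j)(B)
    over the pairs with i, j and i + j all nonzero ([a_coef_jacobi]): the pair
    (0, 0) gives q, the pairs with one zero entry give 0, and the pairs (i, -i)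
    cancel the count at infinity except for the 1 that the trivial character
    contributes to it. Each Jacobi sum J(i, j) that remains has absolute value
    sqrt q ([norm_jacobi]).

    Expanding a^k and summing over A and B, orthogonality keeps exactly the
    k-tuples of pairs (i, j) whose i's sum to 0 and whose j's sum to 0; each
    contributes (q - 1)^2 times its product of k Jacobi sums. The i's form a k-tuple of nonzero elements of Z/l
    with sum 0, and there are (l - 1) ((l - 1)^(k-1) - (-1)^(k-1)) / l of
    those. Given the i's, each j avoids the two values 0 and -i, and the last
    j is determined by the others, which leaves at most (l - 2)^(k-1) choices.

    Rather than handle tuples, the proof twists the moments by characters,
      T_k(a, b) = sum over A, B of a(A, B)^k chi(a)(A) chi(b)(B).
    Multiplying by one more factor a(A, B) shifts the twist, so that
      T_(k+1)(a, b) = sum of J(i, j) T_k(a - i, b - j)     ([momentS]),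
    and the count above becomes an induction on k ([norm_moment]). The
    complex numbers are needed only up to algebraic ones, so the bound is
    first shown in algC; squaring makes it an inequality between rational
    numbers, which then holds in any real field. *)

(** * Logarithm modulo l *)

Record residue_index {F : finFieldType} {l : nat} (dl : F -> 'F_l) : Prop :=
  ResidueIndex {
    dlM : forall x y, x != 0 -> y != 0 -> dl (x * y) = dl x + dl y;
    dl_onto : exists2 g, g != 0 & dl g = 1;
    dl_roots : forall u, u != 0 ->
      #|[set x | x ^+ l == u]| = ((dl u == 0%R) * l)%N }.

(** F^* is cyclic with l dividing its order, so the exponent with respect to
    a generator g is well defined modulo l, and the l-th roots of g^(l c) are
    the translates by g^c of the l-th roots of unity. *)
Lemma residue_index_exists (F : finFieldType) (l : nat) :
  prime l -> (l %| #|F| - 1)%N -> exists dl : F -> 'F_l, residue_index dl.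
Proof.
move=> pl /dvdnP[m qE]; set q1 := (#|F| - 1)%N in qE.
have q_gt1 : (1 < #|F|)%N := finNzRing_gt1 F.
have q1_gt0 : (0 < q1)%N by rewrite subn_gt0.
have q1S : #|F| = q1.+1 by rewrite /q1 subn1 prednK // ltnW.
have fermat (x : F) : x != 0 -> x ^+ q1 = 1.
  move=> x0; apply: (mulfI x0); rewrite mulr1 -exprS -q1S; exact: expf_card.
have [g gP] : exists g : F, q1.-primitive_root g.
  suff /hasP[g _ gP] : has q1.-primitive_root (enum (predC1 (0 : F))) by exists g.
  apply: has_prim_root => //.
  - apply/allP=> x; rewrite mem_enum => x0.
    by apply/unity_rootP/fermat.
  - exact: enum_uniq.
  - by rewrite -cardE cardC1 /q1 subn1.
have g0 : g != 0.
  apply: contraTneq q1_gt0 => gE; have := prim_expr_order gP.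
  by rewrite gE expr0n; case: (q1) => //= n /eqP; rewrite eq_sym oner_eq0.
have l0 := prime_gt0 pl.
have pchl := pchar_Fp pl.
pose log x := if [pick i : 'I_q1 | x == g ^+ i] is Some i then val i else 0%N.
have logK x : x != 0 -> g ^+ log x = x.
  move/fermat/(prim_rootP gP) => [i xE]; rewrite /log; case: pickP => [j /eqP //|].
  by move/(_ i); rewrite xE eqxx.
have modl i j : g ^+ i = g ^+ j -> i%:R = j%:R :> 'F_l.
  move=> /eqP; rewrite (eq_prim_root_expr gP) => /eqP ij.
  rewrite -(Fp_nat_mod pl i) -(Fp_nat_mod pl j).
  by rewrite -(@modn_dvdm q1 i l) ?ij ?modn_dvdm // qE dvdn_mull.
exists (fun x => (log x)%:R); split.
- move=> x y x0 y0; rewrite -natrD; apply: modl.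
  by rewrite exprD !logK // mulf_neq0.
- by exists g => //; apply: (modl _ 1%N); rewrite logK.
- move=> u u0 /=; have [|lu] := boolP ((log u)%:R == 0 :> 'F_l).
    rewrite -(dvdn_pcharf pchl) => /dvdnP[c uE].
    have wP : l.-primitive_root (g ^+ m).
      have := exp_prim_root gP m; rewrite (gcdn_idPl _) ?qE ?dvdn_mulr //.
      rewrite mulKn //; move: q1_gt0; rewrite qE muln_gt0; by case/andP.
    have -> : [set x | x ^+ l == u] = [set g ^+ c * (g ^+ m) ^+ val i | i : 'I_l].
      apply/setP=> x; rewrite inE; apply/eqP/imsetP=> [xu|[i _ ->]].
        have gc0 : g ^+ c != 0 by rewrite expf_neq0.
        have : (x / g ^+ c) ^+ l = 1.
          by rewrite expr_div_n xu -exprM -uE logK // divff.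
        case/(prim_rootP wP)=> i xE; exists i => //.
        by rewrite -xE mulrC divfK.
      by rewrite exprMn [_ ^+ i ^+ l]exprAC (prim_expr_order wP) expr1n mulr1 -exprM -uE logK.
    rewrite card_imset ?card_ord ?mul1n // => i j /(mulfI (expf_neq0 c g0)) /eqP.
    rewrite (eq_prim_root_expr wP) !modn_small ?ltn_ord // => /eqP; exact: val_inj.
  rewrite mul0n; apply: eq_card0 => x; rewrite inE; apply: contraNF lu => /eqP xu.
  have x0 : x != 0 by apply: contraNneq u0 => x0; rewrite -xu x0 expr0n gtn_eqF.
  rewrite (_ : (log u)%:R = (log x * l)%:R).
    by rewrite natrM (pchar_Fp_0 pl) mulr0.
  by apply: modl; rewrite exprM !logK.
Qed.

(** * Points of the curve in coordinates *)

Section PointCount.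
Variables (F : finFieldType) (l : nat).
Hypothesis l_gt0 : (0 < l)%N.

Definition row3 (x y t : F) : 'rV[F]_3 := \row_j [:: x; y; t]`_j.

Lemma row3P (u v : 'rV[F]_3) :
  u 0 0 = v 0 0 -> u 0 1 = v 0 1 -> u 0 2 = v 0 2 -> u = v.
Proof.
move=> E0 E1 E2; apply/rowP=> -[[|[|[|//]]] lti].
- by rewrite (_ : Ordinal lti = 0) //; apply: val_inj.
- by rewrite (_ : Ordinal lti = 1) //; apply: val_inj.
- by rewrite (_ : Ordinal lti = 2) //; apply: val_inj.
Qed.

(** The chart z = 1 together with its complement, the points [x : 1 : 0]
    of the line at infinity; only [1 : 0 : 0] is missed, and it lies on no
    curve A x^l + B y^l = z^l with A != 0. *)
Definition normalized_point (w : F * F + F) : 'rV[F]_3 :=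
  match w with inl (x, y) => row3 x y 1 | inr x => row3 x 1 0 end.

Lemma normalized_point_neq0 w : normalized_point w != 0.
Proof.
apply/eqP; case: w => [[x y]|x] /= /rowP.
  by move/(_ 2); rewrite !mxE /= => /eqP; rewrite oner_eq0.
by move/(_ 1); rewrite !mxE /= => /eqP; rewrite oner_eq0.
Qed.

Lemma proj_point_normalized_inj : injective (@proj_point F \o normalized_point).
Proof.
move=> w w' /= eqw.
have : normalized_point w \in proj_point (normalized_point w').
  by rewrite -eqw; apply/imsetP; exists 1; rewrite ?inE ?oner_eq0 ?scale1r.
case/imsetP=> c; rewrite inE => c0 /rowP E.
have := E 0; have := E 1; have := E 2; rewrite !mxE {eqw E}.
case: w w' => [[x y]|x] [[x' y']|x'] /=; rewrite ?mxE /= ?mulr1 ?mulr0.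
- by move=> <-; rewrite !mul1r => -> ->.
- by move/eqP; rewrite oner_eq0.
- by move/eqP; rewrite eq_sym (negPf c0).
- by move=> _ <-; rewrite mul1r => ->.
Qed.

Lemma proj_point_scale c (v : 'rV[F]_3) :
  c != 0 -> proj_point (c *: v) = proj_point v.
Proof.
move=> c0; apply/setP=> w; apply/imsetP/imsetP=> -[d]; rewrite inE => d0 ->.
  by exists (d * c); rewrite ?inE ?mulf_neq0 ?scalerA.
by exists (d / c); rewrite ?inE ?mulf_neq0 ?invr_eq0 // scalerA divfK.
Qed.

Lemma on_curve_scale c A B (v : 'rV[F]_3) :
  c != 0 -> on_curve l A B (c *: v) = on_curve l A B v.
Proof.
move=> c0; rewrite /on_curve !mxE !exprMn !(mulrCA _ (c ^+ l)) -mulrDr.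
by rewrite (inj_eq (mulfI (expf_neq0 l c0))).
Qed.

Lemma normalize (v : 'rV[F]_3) : v 0 2 != 0 \/ v 0 1 != 0 ->
  exists c w, c != 0 /\ v = c *: normalized_point w.
Proof.
have [t0|t0] := eqVneq (v 0 2) 0 => y0.
  have {}y0 : v 0 1 != 0 by case: y0.
  exists (v 0 1), (inr (v 0 0 / v 0 1)); split=> //.
  by apply: row3P; rewrite !mxE /= ?mulr1 ?mulr0 // mulrC divfK.
exists (v 0 2), (inl (v 0 0 / v 0 2, v 0 1 / v 0 2)); split=> //.
by apply: row3P; rewrite !mxE /= ?mulr1 // mulrC divfK.
Qed.

Lemma card_curve_points (A B : F) : A != 0 ->
  #|curve_points l A B| = (\sum_x \sum_y (A * x ^+ l + B * y ^+ l == 1)%R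
                         + \sum_x (A * x ^+ l + B == 0)%R)%N.
Proof.
move=> A0.
have -> : curve_points l A B =
    (@proj_point F \o normalized_point) @:
      [set w | on_curve l A B (normalized_point w)].
  apply/setP=> P; apply/imsetP/imsetP=> -[].
    move=> v; rewrite inE => /andP[v0 vC] ->.
    have [c [w [c0 vE]]] : exists c w, c != 0 /\ v = c *: normalized_point w.
      apply: normalize; apply/orP; apply: contraNT v0.
      rewrite negb_or !negbK => /andP[/eqP t0 /eqP y0].
      move: vC; rewrite /on_curve t0 y0 expr0n gtn_eqF // mulr0 addr0.
      rewrite mulf_eq0 (negPf A0) expf_eq0 l_gt0 /= => /eqP x0.
      by apply/eqP/row3P; rewrite mxE.
    exists w; first by rewrite inE -(on_curve_scale _ _ _ _ c0) -vE.
    by rewrite vE proj_point_scale.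
  move=> w; rewrite inE => wC ->; exists (normalized_point w) => //.
  by rewrite inE normalized_point_neq0.
rewrite (card_imset _ proj_point_normalized_inj) -sum1_card big_sumType.
congr (_ + _)%N.
  rewrite pair_bigA big_mkcond; apply: eq_bigr => -[x y] _.
  by rewrite inE /on_curve !mxE /= expr1n; case: eqP.
rewrite big_mkcond; apply: eq_bigr => x _.
by rewrite inE /on_curve !mxE /= expr1n mulr1 expr0n gtn_eqF //; case: eqP.
Qed.
End PointCount.

(** * Tuples of nonzero residues with prescribed sum *)

(** The number of k-tuples of nonzero elements of Z/l with sum a, where b
    records whether a is 0: among all (l - 1)^k tuples the sums are equally
    distributed, up to an excess (-1)^k at 0. The recursion
    [nonzero_sumsS] on the first entry characterizes it. *)
Definition nonzero_sums (K : fieldType) (l k : nat) (b : bool) : K :=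
  ((l%:R - 1) ^+ k - (- 1) ^+ k) / l%:R + b%:R * (- 1) ^+ k.

Lemma nonzero_sums0 K l b : nonzero_sums K l 0 b = b%:R.
Proof. by rewrite /nonzero_sums !expr0 subrr mul0r add0r mulr1. Qed.

Lemma nonzero_sums_true (K : numFieldType) l k : (0 < l)%N ->
  nonzero_sums K l k.+1 true =
  (l%:R - 1) * (((l%:R - 1) ^+ k - (- 1) ^+ k) / l%:R).
Proof.
move=> l0; have lK : l%:R != 0 :> K by rewrite pnatr_eq0 -lt0n.
rewrite /nonzero_sums !exprS mulr1n.
by move: ((-1) ^+ k) ((l%:R - 1) ^+ k) => s t; field.
Qed.

Lemma nonzero_sumsS (K : numFieldType) l k (a : 'F_l) : prime l ->
  nonzero_sums K l k.+1 (a == 0) =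
  \sum_(i | i != 0) nonzero_sums K l k (a - i == 0).
Proof.
move=> pl; have lK : l%:R != 0 :> K by rewrite pnatr_eq0 -lt0n prime_gt0.
have lS : l = l.-1.+1 by rewrite prednK // prime_gt0.
have lE : l%:R = l.-1%:R + 1 :> K by rewrite natr1 -lS.
rewrite /nonzero_sums big_split /= sumr_const -[#|_|]/#|predC1 (0 : 'F_l)|.
rewrite cardC1 card_Fp // -[_ *+ l.-1]mulr_natr -mulr_suml.
rewrite (_ : \sum_(i | i != 0) _ = (a != 0)%:R); last first.
  have [->|a0] := eqVneq a 0.
    by apply: big1 => i i0; rewrite sub0r oppr_eq0 (negPf i0).
  rewrite (bigD1 a) //= subrr eqxx big1 ?addr0 // => i /andP[_ ia].
  by rewrite subr_eq0 eq_sym (negPf ia).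
move: lK; rewrite lE => lK; rewrite !exprS.
move: ((-1) ^+ k) ((l.-1%:R + 1 - 1) ^+ k) => s t.
by case: eqP => _ /=; field.
Qed.

(** * Characters of order dividing l *)

Section Characters.
Variables (F : finFieldType) (l : nat) (dl : F -> 'F_l) (z : algC).
Hypothesis pl : prime l.
Hypothesis dlP : residue_index dl.
Hypothesis zP : l.-primitive_root z.
Local Notation q := (#|F|%:R : algC).

Definition addchar (i : 'F_l) : algC := z ^+ i.

Lemma addchar0 : addchar 0 = 1. Proof. by rewrite /addchar expr0. Qed.

Lemma addcharD i j : addchar (i + j) = addchar i * addchar j.
Proof.
rewrite -[i in LHS]natr_Zp -[j in LHS]natr_Zp -natrD /addchar val_Fp_nat //.
by rewrite (prim_expr_mod zP) exprD.
Qed.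

Lemma addchar_eq1 i : (addchar i == 1) = (i == 0).
Proof.
rewrite /addchar -(prim_order_dvd zP) (dvdn_pcharf (pchar_Fp pl)).
by rewrite natr_Zp.
Qed.

Lemma norm_addchar i : `|addchar i| = 1.
Proof.
have /eqP : `|z| == 1.
  by rewrite -(@pexpr_eq1 _ _ l) ?prime_gt0 // -normrX (prim_expr_order zP) normr1.
by rewrite normrX => ->; rewrite expr1n.
Qed.

Lemma sum_addchar a : \sum_i addchar (i * a) = ((a == 0) * l)%:R.
Proof.
have [->|a0] := eqVneq a 0.
  rewrite (eq_bigr (fun=> 1)) => [|i _]; last by rewrite mulr0 addchar0.
  by rewrite sumr_const card_Fp // mul1n.
set s := \sum_i _; rewrite mul0n.
have : addchar a * s = s.
  rewrite [RHS](reindex_inj (addrI 1)) mulr_sumr.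
  by apply: eq_bigr => i _; rewrite mulrDl mul1r addcharD.
move/eqP; rewrite -subr_eq0 -{2}[s]mul1r -mulrBl mulf_eq0 subr_eq0.
by rewrite addchar_eq1 (negPf a0) => /eqP.
Qed.

(** The trivial character takes the value 1 at 0 and the others the value 0:
    with this convention [card_roots] and the multiplicativity [chiM] hold at
    0 as well. *)
Definition chi (i : 'F_l) (x : F) : algC :=
  if x == 0 then (i == 0)%:R else addchar (i * dl x).

Lemma chi0 i : chi i 0 = (i == 0)%:R. Proof. by rewrite /chi eqxx. Qed.

Lemma chi_triv x : chi 0 x = 1.
Proof. by rewrite /chi eqxx mul0r addchar0; case: ifP. Qed.

Lemma dl1 : dl 1 = 0.
Proof.
by have := dlM _ dlP 1 1 (oner_neq0 F) (oner_neq0 F); rewrite mulr1 -[LHS]addr0 => /addrI.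
Qed.

Lemma chi1 i : chi i 1 = 1.
Proof. by rewrite /chi oner_eq0 dl1 mulr0 addchar0. Qed.

Lemma chiM i x y : chi i (x * y) = chi i x * chi i y.
Proof.
have [->|i0] := eqVneq i 0; first by rewrite !chi_triv mulr1.
rewrite /chi mulf_eq0 (negPf i0).
have [|x0] := boolP (x == 0); first by rewrite mul0r.
have [|y0] /= := boolP (y == 0); first by rewrite mulr0.
by rewrite (dlM _ dlP) // mulrDr addcharD.
Qed.

Lemma chiD i j x : x != 0 -> chi (i + j) x = chi i x * chi j x.
Proof. by move=> x0; rewrite /chi (negPf x0) mulrDl addcharD. Qed.

Lemma chiN i x : chi (- i) x = chi i x^-1.
Proof.
have [->|x0] := eqVneq x 0; first by rewrite invr0 !chi0 oppr_eq0.
have nz : chi i x != 0.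
  by rewrite /chi (negPf x0) -normr_gt0 norm_addchar.
by apply: (mulfI nz); rewrite -chiD // -chiM subrr chi_triv divff // chi1.
Qed.

Lemma norm_chi i x : x != 0 -> `|chi i x| = 1.
Proof. by move=> x0; rewrite /chi (negPf x0) norm_addchar. Qed.

Lemma conj_chi i x : (chi i x)^* = chi i x^-1.
Proof.
have [->|x0] := eqVneq x 0; first by rewrite invr0 chi0 conjC_nat.
have nz : chi i x != 0 by rewrite -normr_gt0 norm_chi.
by apply: (mulfI nz); rewrite -normCK norm_chi // -chiM divff // chi1 expr1n.
Qed.

Lemma sum_chi i : \sum_x chi i x = (i == 0)%:R * q.
Proof.
have [->|i0] := eqVneq i 0.
  rewrite (eq_bigr (fun=> 1)) => [|x _]; last exact: chi_triv.
  by rewrite sumr_const mul1r.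
have [g g0 dlg] := dl_onto _ dlP; rewrite mul0r; set s := \sum_x _.
have : chi i g * s = s.
  rewrite [RHS](reindex_inj (mulfI g0)) mulr_sumr.
  by apply: eq_bigr => x _; rewrite chiM.
move/eqP; rewrite -subr_eq0 -{2}[s]mul1r -mulrBl mulf_eq0 subr_eq0.
by rewrite /chi (negPf g0) dlg mulr1 addchar_eq1 (negPf i0) => /eqP.
Qed.

Lemma sum_chi_neq0 i : \sum_(x | x != 0) chi i x = (i == 0)%:R * (q - 1).
Proof.
have := sum_chi i; rewrite (bigD1 0) //= chi0 => /(canRL (addKr _)) ->.
by case: eqP => _; ring.
Qed.

(** This is how characters enter: the sum over i detects whether u is an l-th
    power, and gives 1 at u = 0, where only the trivial character counts. *)
Lemma card_roots u : #|[set x | x ^+ l == u]|%:R = \sum_i chi i u.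
Proof.
have [->|u0] := eqVneq u 0.
  rewrite (bigD1 0) //= chi_triv big1 ?addr0 => [|i /negPf i0]; last first.
    by rewrite chi0 i0.
  rewrite (_ : [set x | x ^+ l == 0] = [set 0]) ?cards1 //.
  by apply/setP=> x; rewrite !inE expf_eq0 prime_gt0.
rewrite (dl_roots _ dlP) // -sum_addchar.
by apply: eq_bigr => i _; rewrite /chi (negPf u0).
Qed.

(** * Jacobi sums *)

Definition jacobi (i j : 'F_l) : algC := \sum_x chi i x * chi j (1 - x).

Lemma jacobi00 : jacobi 0 0 = q.
Proof.
rewrite /jacobi (eq_bigr (fun=> 1)) => [|x _]; last by rewrite !chi_triv mulr1.
by rewrite sumr_const.
Qed.

Lemma sum_chi_inj i (h : F -> F) :
  injective h -> i != 0 -> \sum_x chi i (h x) = 0.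
Proof.
move=> hI i0; transitivity (\sum_x chi i x); first by rewrite [RHS](reindex_inj hI).
by rewrite sum_chi (negPf i0) mul0r.
Qed.

Lemma jacobi_l0 i : i != 0 -> jacobi i 0 = 0.
Proof.
move=> i0; rewrite -[RHS](sum_chi_inj i id (fun _ _ => id) i0).
by apply: eq_bigr => x _; rewrite chi_triv mulr1.
Qed.

Lemma subl_inj (a : F) : injective (fun x : F => a - x).
Proof. by move=> x y /addrI/oppr_inj. Qed.

Lemma jacobiC i j : jacobi i j = jacobi j i.
Proof.
rewrite /jacobi (reindex_inj (subl_inj 1)); apply: eq_bigr => x _ /=.
by rewrite subKr mulrC.
Qed.

(** Since chi(i)(x) chi(-i)(1 - x) = chi(-i)(1/x - 1), and 1/x - 1 runs over
    everything but -1, this is a complete character sum without its term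
    at -1. *)
Lemma jacobiN i : i != 0 -> jacobi i (- i) = - chi i (-1).
Proof.
move=> i0; rewrite /jacobi (bigD1 0) //= chi0 (negPf i0) mul0r add0r.
transitivity (\sum_(x | x != 0) chi (- i) (x^-1 - 1)).
  apply: eq_bigr => x x0; rewrite -[x in chi i x]invrK -chiN -chiM.
  by rewrite mulrBr mulr1 mulVf.
have := sum_chi_inj (- i) (fun x => x^-1 - 1).
rewrite (bigD1 0) //= invr0 sub0r chiN invrN invr1 oppr_eq0 => sum0.
by apply/eqP; rewrite -addr_eq0 addrC sum0 // => x y /addIr/invr_inj.
Qed.

(** The map y |-> s + (1 - s) / (1 - y) equals (1 - s y) / (1 - y) for
    y != 1 and, as 1 / 0 = 0, permutes F with value s at y = 1. So the sum is
    a complete character sum except for the term chi(j)(s). *)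
Lemma sum_chi_moebius j s : j != 0 -> s != 1 ->
  \sum_y chi j ((1 - s * y) / (1 - y)) = - chi j s.
Proof.
move=> j0 s1; have s1' : 1 - s != 0 by rewrite subr_eq0 eq_sym.
have := sum_chi_inj j (fun y => s + (1 - s) / (1 - y)).
rewrite (bigD1 1) //= subrr invr0 mulr0 addr0 => sum0.
rewrite (bigD1 1) //= subrr invr0 mulr0 chi0 (negPf j0) add0r.
apply/eqP; rewrite -addr_eq0 addrC; apply/eqP.
rewrite -[RHS](sum0 _ j0) => [|x y /addrI/(mulfI s1')/invr_inj/subl_inj //].
congr (_ + _); apply: eq_bigr => y y1; congr (chi j _).
by field; rewrite subr_eq0 eq_sym.
Qed.

(** |J|^2 is the double sum of chi(i)(x / y) chi(j)((1 - x) / (1 - y)). The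
    substitution x = s y leaves a sum over y of chi(j) at a homography, known
    from [sum_chi_moebius] except for s = 1, where it is q - 1. What remains is
    the complete sum of chi(i + j), again without its term at 1. *)
Lemma norm_jacobi i j : i != 0 -> j != 0 -> i + j != 0 ->
  `|jacobi i j| = sqrtC q.
Proof.
move=> i0 j0 ij0; apply/eqP.
rewrite -(@eqrXn2 _ 2) ?normr_ge0 ?sqrtC_ge0 ?ler0n // sqrtCK normCK.
rewrite [X in _ * X]rmorph_sum mulr_sumr.
rewrite (eq_bigr (fun y =>
    \sum_s chi i s * chi j ((1 - s * y) / (1 - y)))) => [|y _]; last first.
  (* At y = 0 the substitution x = s y is not available, but both sides
     vanish: the left one since chi i 0 = 0, the right one as a complete sum. *)
  rewrite rmorphM /= !conj_chi; have [->|y0] := eqVneq y 0.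
    rewrite invr0 chi0 (negPf i0) mul0r mulr0 -[LHS](sum_chi_inj i id (fun _ _ => id) i0).
    by apply: eq_bigr => x _; rewrite mulr0 subr0 divr1 chi1 mulr1.
  rewrite /jacobi mulr_suml (reindex_inj (mulIf y0)); apply: eq_bigr => s _ /=.
  by rewrite mulrACA -!chiM mulfK.
rewrite exchange_big (bigD1 1) //=.
have -> : \sum_y chi i 1 * chi j ((1 - 1 * y) / (1 - y)) = #|F|.-1%:R.
  rewrite (bigD1 1) //= subrr invr0 mulr0 chi0 (negPf j0) mulr0 add0r.
  rewrite (eq_bigr (fun=> 1)) => [|y y1]; last first.
    by rewrite mul1r divff ?chi1 ?mulr1 // subr_eq0 eq_sym.
  by rewrite sumr_const -[#|_|]/#|predC1 (1 : F)| cardC1.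
rewrite (eq_bigr (fun s => - chi (i + j) s)) => [|s s1]; last first.
  rewrite -mulr_sumr sum_chi_moebius // mulrN.
  have [->|s0] := eqVneq s 0; last by rewrite chiD.
  by rewrite !chi0 (negPf i0) (negPf ij0) mul0r.
rewrite sumrN; have := sum_chi_inj (i + j) id (fun _ _ => id) ij0.
rewrite (bigD1 1) //= chi1 => /eqP.
rewrite addrC addr_eq0 => /eqP ->.
by rewrite opprK natr1 prednK // ltnW // finNzRing_gt1.
Qed.

(** * Fourier expansion of the point count *)

Lemma card_scaled_roots A u : A != 0 ->
  (\sum_x (A * x ^+ l == u)%R)%N%:R = \sum_i chi i (u / A).
Proof.
move=> A0; rewrite -card_roots -sum1_card [in RHS]big_mkcond; congr (_%:R).
apply: eq_bigr => x _; rewrite inE (can2_eq (mulKf A0) (mulVKf A0)) mulrC.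
by case: eqP.
Qed.

(** The affine points contribute all pairs (i, j), and for i != 0 the pair
    (i, -i) cancels the i-th term of the count at infinity, because
    J(i, -i) = - chi(i)(-1). *)
Lemma a_coef_jacobi A B : A != 0 -> B != 0 ->
  (a_coef l A B)%:~R =
  \sum_(i | i != 0) \sum_(j | (j != 0) && (i + j != 0))
     jacobi i j * (chi (- i) A * chi (- j) B).
Proof.
move=> A0 B0; have l0 := prime_gt0 pl.
rewrite /a_coef card_curve_points // rmorphB /= -!pmulrn !natrD.
have -> : (\sum_x \sum_y (A * x ^+ l + B * y ^+ l == 1)%R)%N%:R =
    \sum_i \sum_j jacobi i j * (chi (- i) A * chi (- j) B).
  transitivity (\sum_u (\sum_x (A * x ^+ l == u)%R)%N%:R *
                       (\sum_y (B * y ^+ l == 1 - u)%R)%N%:R : algC).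
    rewrite natr_sum.
    rewrite [RHS](eq_bigr (fun u => \sum_x \sum_y
       ((A * x ^+ l == u) * (B * y ^+ l == 1 - u)%R)%:R)) => [|u _]; last first.
      rewrite -natrM big_distrl natr_sum; apply: eq_bigr => x _.
      by rewrite big_distrr natr_sum.
    rewrite [RHS]exchange_big; apply: eq_bigr => x _.
    rewrite [RHS]exchange_big natr_sum; apply: eq_bigr => y _.
    rewrite (bigD1 (A * x ^+ l)) //= eqxx mul1n big1 => [|u /negPf uN]; last first.
      by rewrite eq_sym uN.
    by rewrite addr0 addrC eq_sym -subr_eq eq_sym.
  transitivity (\sum_u \sum_i \sum_j
      chi i u * chi j (1 - u) * (chi (- i) A * chi (- j) B)).
    apply: eq_bigr => u _; rewrite !card_scaled_roots // big_distrlr /=.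
    apply: eq_bigr => i _; apply: eq_bigr => j _.
    by rewrite !chiM !chiN mulrACA.
  rewrite exchange_big; apply: eq_bigr => i _.
  by rewrite exchange_big; apply: eq_bigr => j _; rewrite -mulr_suml.
have -> : (\sum_x (A * x ^+ l + B == 0)%R)%N%:R =
    1 + \sum_(i | i != 0) chi i (-1) * (chi (- i) A * chi i B).
  rewrite (eq_bigr (fun x => (A * x ^+ l == - B) : nat)) => [|x _]; last first.
    by rewrite addr_eq0.
  rewrite card_scaled_roots // (bigD1 0) //= chi_triv; congr (_ + _).
  by apply: eq_bigr => i _; rewrite -(mulN1r B) !chiM -chiN -mulrA [chi i B * _]mulrC.
rewrite (bigD1 0) //= (bigD1 0) //= big1 => [|j j0]; last first.
  by rewrite jacobiC jacobi_l0 // mul0r.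
rewrite jacobi00 oppr0 !chi_triv !mulr1 addr0.
set S1 := \sum_(i | _) _; set S2 := \sum_(i | _) _; set S3 := \sum_(i | _) _.
suff -> : S1 = S3 - S2 by ring.
rewrite -sumrB; apply: eq_bigr => i i0.
rewrite (bigD1 0) //= jacobi_l0 // mul0r add0r (bigD1 (- i)) ?oppr_eq0 //=.
rewrite jacobiN // opprK addrC mulNr; congr (_ - _).
by apply: eq_bigl => j; rewrite addrC addr_eq0.
Qed.

(** * Twisted moments *)

Definition moment k (a b : 'F_l) : algC :=
  \sum_(A | A != 0) \sum_(B | B != 0)
    (a_coef l A B)%:~R ^+ k * (chi a A * chi b B).

Lemma moment0 a b :
  moment 0 a b = (a == 0)%:R * (b == 0)%:R * (q - 1) ^+ 2.
Proof.
rewrite expr2 mulrACA -!sum_chi_neq0 big_distrlr /=.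
by apply: eq_bigr => A _; apply: eq_bigr => B _; rewrite mul1r.
Qed.

Lemma momentS k a b :
  moment k.+1 a b = \sum_(i | i != 0) \sum_(j | (j != 0) && (i + j != 0))
    jacobi i j * moment k (a - i) (b - j).
Proof.
transitivity (\sum_(A | A != 0) \sum_(B | B != 0)
    \sum_(i | i != 0) \sum_(j | (j != 0) && (i + j != 0)) jacobi i j *
      ((a_coef l A B)%:~R ^+ k * (chi (a - i) A * chi (b - j) B))).
  apply: eq_bigr => A A0; apply: eq_bigr => B B0.
  rewrite exprS {1}a_coef_jacobi // -mulrA mulr_suml; apply: eq_bigr => i _.
  rewrite mulr_suml; apply: eq_bigr => j _.
  by rewrite !chiD //; ring.
under eq_bigr => A _ do rewrite exchange_big.
rewrite exchange_big; apply: eq_bigr => i _.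
under eq_bigr => A _ do rewrite exchange_big.
rewrite exchange_big; apply: eq_bigr => j _.
rewrite mulr_sumr; apply: eq_bigr => A _.
by rewrite mulr_sumr.
Qed.

Lemma card_nontrivial_pairs (i : 'F_l) : i != 0 ->
  #|[pred j : 'F_l | (j != 0) && (i + j != 0)]|%:R = l%:R - 2 :> algC.
Proof.
move=> i0; have := card_Fp pl; rewrite (cardD1 0) (cardD1 (- i)) !inE oppr_eq0 i0.
rewrite andbT !add1n => lE; rewrite -[in RHS]lE -!natr1.
set c := #|_|; set d := #|_|; suff -> : c = d by ring.
by apply: eq_card => j; rewrite !inE andbT andbC [i + j]addrC addr_eq0.
Qed.

(** The sum over j contributes at most one nonzero term to the first moment,
    and afterwards a factor l - 2 at each step: this gives the exponent k for
    the moment of order k + 1. *)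
Lemma norm_moment k a b :
  `|moment k.+1 a b| <= sqrtC q ^+ k.+1 * (q - 1) ^+ 2 * (l%:R - 2) ^+ k
                        * nonzero_sums algC l k.+1 (a == 0).
Proof.
have J0 : 0 <= sqrtC q by rewrite sqrtC_ge0 ler0n.
elim: k a b => [|k IHk] a b; rewrite momentS nonzero_sumsS // mulr_sumr.
  apply: le_trans (ler_norm_sum _ _ _) _; apply: ler_sum => i i0.
  rewrite expr0 mulr1 nonzero_sums0.
  apply: le_trans (ler_norm_sum _ _ _) _.
  rewrite (eq_bigr (fun j => sqrtC q * (q - 1) ^+ 2 * (a - i == 0)%:R * (b - j == 0)%:R)).
    rewrite -mulr_sumr ler_piMr //.
      by rewrite !mulr_ge0 ?ler0n // subr_ge0 ler1n ltnW // finNzRing_gt1.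
    apply: le_trans (_ : \sum_j (b - j == 0)%:R <= _).
      by rewrite [leRHS](bigID [pred j | (j != 0) && (i + j != 0)]) /= lerDl sumr_ge0.
    by rewrite (bigD1 b) //= subrr eqxx big1 ?addr0 // => j; rewrite subr_eq0 eq_sym => /negPf ->.
  move=> j /andP[j0 ij0]; rewrite normrM norm_jacobi // moment0.
  rewrite ger0_norm; first by ring.
  by rewrite !mulr_ge0 ?ler0n // subr_ge0 ler1n ltnW // finNzRing_gt1.
apply: le_trans (ler_norm_sum _ _ _) _; apply: ler_sum => i i0.
apply: le_trans (ler_norm_sum _ _ _) _.
apply: le_trans (_ : \sum_(j | (j != 0) && (i + j != 0)) sqrtC q *
   (sqrtC q ^+ k.+1 * (q - 1) ^+ 2 * (l%:R - 2) ^+ k * nonzero_sums algC l k.+1 (a - i == 0)) <= _).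
  apply: ler_sum => j /andP[j0 ij0].
  by rewrite normrM norm_jacobi // ler_wpM2l.
rewrite sumr_const -[X in X <= _]mulr_natr (card_nontrivial_pairs i i0).
rewrite le_eqVlt; apply/orP; left; apply/eqP; rewrite [in RHS]exprS.
by rewrite [(l%:R - 2) ^+ k.+1]exprS; ring.
Qed.
End Characters.

(** * The bound *)

Lemma sum_a_coef_le (F : finFieldType) (l k : nat) :
    prime l -> (l %| #|F| - 1)%N ->
  `|(\sum_(A : F | A != 0) \sum_(B : F | B != 0) a_coef l A B ^+ k.+1)%:~R| <=
    sqrtC #|F|%:R ^+ k.+1 * (#|F|%:R - 1) ^+ 2 * (l%:R - 2) ^+ k
     * nonzero_sums algC l k.+1 true.
Proof.
move=> pl /(residue_index_exists _ _ pl)[dl dlP].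
have [z zP] := C_prim_root_exists (prime_gt0 pl).
have := norm_moment F l dl z pl dlP zP k 0 0; rewrite eqxx; congr (`|_| <= _).
rewrite rmorph_sum; apply: eq_bigr => A _; rewrite rmorph_sum.
by apply: eq_bigr => B _; rewrite rmorphXn !chi_triv // !mulr1.
Qed.

Lemma powR_half_sqr (R : realType) (x : R) k : 0 <= x ->
  (x `^ (k%:R / 2)) ^+ 2 = x ^+ k.
Proof.
by move=> x0; rewrite -powR_mulrn ?powR_ge0 // -powRrM divfK ?pnatr_eq0 // powR_mulrn.
Qed.

Theorem proposition4 (R : realType) (F : finFieldType) (q l k : nat)
    (hq : #|F| = q) (hl : prime l) (hlq : (l %| q - 1)%N) (hk : (1 <= k)%N) :
  `| (\sum_(A : F | A != 0) \sum_(B : F | B != 0) a_coef l A B ^+ k)%:~R | <=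
    q%:R `^ (k%:R / 2) * (q%:R - 1) ^+ 2 * (l%:R - 1) * (l%:R - 2) ^+ (k - 1)
    * (((l%:R - 1) ^+ (k - 1) - (-1) ^+ (k - 1)) / l%:R) :> R.
Proof.
case: k hk => // k _; rewrite (subn1 k.+1) /= -hq in hlq *.
have := sum_a_coef_le F l k hl hlq; set S : int := \sum_(A | _) _.
pose D : rat := (#|F|%:R - 1) ^+ 2 * (l%:R - 2) ^+ k * nonzero_sums rat l k.+1 true.
have DE (K : numFieldType) : ratr D =
    (#|F|%:R - 1) ^+ 2 * (l%:R - 2) ^+ k * nonzero_sums K l k.+1 true.
  rewrite /D /nonzero_sums.
  by rewrite !(rmorphM, rmorphXn, rmorphD, rmorphN, rmorph1, rmorph_nat, fmorphV).
rewrite -2!mulrA [_ * (_ * nonzero_sums _ _ _ _)]mulrA -DE => le_SD.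
have q0 : (0 < #|F|)%N by rewrite ltnW // finNzRing_gt1.
(* Both members must be nonnegative before the bound can be squared. *)
have D0 : 0 <= D.
  rewrite -(ler0q algC) -(pmulr_rge0 _ (_ : 0 < sqrtC #|F|%:R ^+ k.+1)).
    exact: le_trans le_SD.
  by rewrite exprn_gt0 // sqrtC_gt0 ltr0n.
have {}le_SD : S%:~R ^+ 2 <= #|F|%:R ^+ k.+1 * D ^+ 2 :> rat.
  rewrite -(ler_rat algC) rmorphXn rmorphM !rmorphXn rmorph_nat /= ratr_int.
  rewrite -[#|F|%:R in leRHS]sqrtCK exprAC -exprMn -real_normK ?Rreal_int //.
  by rewrite ler_pXn2r // nnegrE (le_trans _ le_SD).
rewrite [leRHS](_ : _ = #|F|%:R `^ (k.+1%:R / 2) * ratr D); last first.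
  by rewrite DE nonzero_sums_true ?prime_gt0 //; ring.
have D0R : 0 <= ratr D :> R by rewrite ler0q.
rewrite -(@ler_pXn2r _ 2) ?nnegrE ?(mulr_ge0 (powR_ge0 _ _) D0R) //.
rewrite real_normK ?num_real // exprMn powR_half_sqr ?ler0n //.
by rewrite -(ler_rat R) rmorphXn rmorphM !rmorphXn rmorph_nat /= ratr_int in le_SD.
Qed.
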